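(* Let $a,b$ be relatively prime integers with $2\le a<b$. Then the number of exceptional values with respect to $a$ and $b$ is exactly $\frac{(a-3)(b-1)}{2}+\left\lfloor \frac{b}{a}\right\rfloor$.
   Context: For relatively prime positive integers $a_1,\dots,a_n$ (each at least 2), the Frobenius number $g(a_1,\dots,a_n)$ is the largest integer not representable as a nonnegative integer linear combination of $a_1,\dots,a_n$. Given relatively prime $a<b$, an integer $c>b$ (with $a,b,c$ relatively prime) is called an exceptional value with respect to $a$ and $b$ if $g(a,b,c)<g(a,b)$. *)

(* Defs.v *)
From mathcomp Require Import all_boot all_order all_algebra.
From mathcomp Require Import finmap.
From mathcomp Require Import boolp classical_sets cardinality.

Set Implicit Arguments.
Unset Strict Implicit.
Unset Printing Implicit Defensive.

Import Order.TTheory GRing.Theory Num.Theory.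

Local Open Scope classical_set_scope.
Local Open Scope ring_scope.

Definition representable (s : seq nat) (m : int) : Prop :=
  exists k : nat -> nat, m = (\sum_(i < size s) k i * nth 0 s i)%N%:Z.

Definition is_frobenius (s : seq nat) (g : int) : Prop :=
  ~ representable s g /\ forall m : int, ~ representable s m -> m <= g.

(* The default value 0 is only used when no largest non-representable integer
   exists (e.g. when the gcd of [s] is not 1). *)
Definition frobenius (s : seq nat) : int :=
  xget 0 [set g : int | is_frobenius s g].

Lemma is_frobenius_inj (s : seq nat) (g h : int) :
  is_frobenius s g -> is_frobenius s h -> g = h.
Proof.
by move=> [ng maxg] [nh maxh]; apply/le_anti; rewrite maxh // maxg.
Qed.

Lemma frobeniusE (s : seq nat) (g : int) : is_frobenius s g -> frobenius s = g.
Proof.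
move=> fg; rewrite /frobenius.
by apply: (is_frobenius_inj _ fg); apply: (xgetPex 0 (P := is_frobenius s)); exists g.
Qed.

Definition exceptional (a b c : nat) : Prop :=
  [/\ (b < c)%N, gcdn (gcdn a b) c = 1%N
    & frobenius [:: a; b; c] < frobenius [:: a; b]].

(* Main.v *)
Require Import Defs.
From mathcomp Require Import all_boot all_order all_algebra.
From mathcomp Require Import finmap.
From mathcomp Require Import boolp classical_sets cardinality.
From mathcomp Require Import zify ring lra.

Set Implicit Arguments.
Unset Strict Implicit.
Unset Printing Implicit Defensive.

Import Order.TTheory GRing.Theory Num.Theory.

Local Open Scope classical_set_scope.
Local Open Scope ring_scope.

(** Every integer is uniquely x a + y b with 0 <= y < a, and it is representable
by a and b iff x >= 0.  For G = ab - a - b, the coordinates of G - m are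
(-1 - x, a - 1 - y), so exactly one of m and G - m is representable; in
particular g(a,b) = G.  Adding c lowers the Frobenius number iff it makes G
representable, i.e. iff some G - zc is representable by a and b, iff some zc is
not, iff c is not.  So the exceptional values are the non-representable c > b.
By the same symmetry half of 0, ..., G are non-representable, which is
(a-1)(b-1)/2 numbers; those up to b are the numbers below b that a does not
divide, of which there are b - 1 - floor(b/a). *)

Section Representable.

Implicit Types (s : seq nat) (m : int).

Lemma representable_ge0 s m : representable s m -> 0 <= m.
Proof. by case=> k ->. Qed.

Lemma representable0 s : representable s 0.
Proof. by exists (fun=> 0%N); rewrite big1. Qed.

Lemma representableMl s m (z : nat) :
  representable s m -> representable s (z%:Z * m).
Proof.
case=> k ->; exists (fun i => z * k i)%N.
rewrite -PoszM big_distrr /=.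
by congr Posz; apply: eq_bigr => i _; rewrite mulnA.
Qed.

Lemma representable_nil m : representable [::] m <-> m = 0.
Proof.
by split=> [[k ->]|->]; [rewrite big_ord0 | exact: representable0].
Qed.

Lemma representable_rcons s (c : nat) m :
  representable (rcons s c) m <->
  exists z : nat, representable s (m - z%:Z * c%:Z).
Proof.
split=> [[k ->]|[z [k mE]]].
  exists (k (size s)), k; rewrite size_rcons big_ord_recr /=.
  rewrite nth_rcons ltnn eqxx.
  under eq_bigr => i _ do rewrite nth_rcons ltn_ord.
  by lia.
exists (fun i => if i == size s then z else k i).
rewrite size_rcons big_ord_recr /= nth_rcons ltnn eqxx.
under eq_bigr => i _ do rewrite nth_rcons ltn_ord (ltn_eqF (ltn_ord i)).
by rewrite PoszD PoszM -mE subrK.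
Qed.

Lemma representable_rconsW s (c : nat) m :
  representable s m -> representable (rcons s c) m.
Proof.
by move=> rep_m; apply/representable_rcons; exists 0%N; rewrite mul0r subr0.
Qed.

Lemma representable_rcons_lt s (c : nat) m :
  m < c%:Z -> representable (rcons s c) m <-> representable s m.
Proof.
move=> lt_mc; split; last exact: representable_rconsW.
move=> /representable_rcons[[|z]]; first by rewrite mul0r subr0.
by move/representable_ge0; nia.
Qed.

Lemma representable1P (a n : nat) : representable [:: a] n <-> (a %| n)%N.
Proof.
split=> [/(representable_rcons [::])[z /representable_nil nE]|/dvdnP[z ->]].
  by apply/dvdnP; exists z; lia.
by apply/(representable_rcons [::]); exists z; apply/representable_nil; lia.
Qed.

Lemma representable2P (a b : nat) m :
  representable [:: a; b] m <-> exists x y : nat, m = x%:Z * a%:Z + y%:Z * b%:Z.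
Proof.
split=> [/(representable_rcons [:: a])[y]|[x [y ->]]].
  move=> /(representable_rcons [::])[x /representable_nil mE].
  by exists x, y; lia.
apply/(representable_rcons [:: a]); exists y.
by apply/(representable_rcons [::]); exists x; apply/representable_nil; lia.
Qed.

End Representable.

Section Frobenius.

Implicit Types (s t : seq nat) (g m : int).

Lemma frobeniusP s g :
  (forall m, g < m -> representable s m) -> is_frobenius s (frobenius s).
Proof.
move=> rep_gt; suff [f fP] : exists f, is_frobenius s f.
  by rewrite (frobeniusE fP).
(* Shifted by 1, as the Frobenius number is -1 when every natural number is
   representable. *)
pose nonrep_pred i := `[< ~ representable s (i%:Z - 1) >].
have nonrep_ex : exists i, nonrep_pred i.
  by exists 0%N; apply/asboolP => /representable_ge0.
have nonrep_le i : nonrep_pred i -> (i <= `|g|.+1)%N.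
  move=> /asboolP nonrep_i; rewrite leqNgt; apply/negP => lt_gi.
  by apply/nonrep_i/rep_gt; lia.
have [i /asboolP nonrep_i max_i] := ex_maxnP nonrep_ex nonrep_le.
exists (i%:Z - 1); split=> // -[m|m] nonrep_m; last by lia.
suff : (m.+1 <= i)%N by lia.
by apply: max_i; apply/asboolP; rewrite intS addrC addKr.
Qed.

Lemma frobenius_lt s t g :
    is_frobenius s g -> (forall m, representable s m -> representable t m) ->
  frobenius t < g <-> representable t g.
Proof.
move=> [nonrep_g max_g] sub_st.
have [nonrep_f max_f] : is_frobenius t (frobenius t).
  apply: (frobeniusP (g := g)) => m lt_gm.
  by apply: sub_st; apply: contrapT => /max_g; rewrite leNgt lt_gm.
split=> [lt_fg|rep_g].
  by apply: contrapT => /max_f; rewrite leNgt lt_fg.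
rewrite lt_neqAle; apply/andP; split; last by apply: max_g => /sub_st.
by apply: contra_notN nonrep_f => /eqP->.
Qed.

(* Equivalently, [s] generates a symmetric numerical semigroup with Frobenius
   number [g]. *)
Definition representable_symmetric s g : Prop :=
  forall m, representable s m <-> ~ representable s (g - m).

Lemma is_frobenius_symmetric s g :
  representable_symmetric s g -> is_frobenius s g.
Proof.
move=> sym_s; split=> [|m nonrep_m].
  by rewrite -[g]subr0; apply/(sym_s 0); exact: representable0.
rewrite -subr_ge0; apply: (@representable_ge0 s).
by apply/sym_s; rewrite subKr.
Qed.

Lemma representable_rcons_symmetric s g (c : nat) :
  representable_symmetric s g ->
  representable (rcons s c) g <-> ~ representable s c.
Proof.
move=> sym_s; split=> [/representable_rcons[z rep_gz]|nonrep_c].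
  by move=> /(representableMl z)/sym_s.
by apply/representable_rcons; exists 1%N; apply/sym_s; rewrite mul1r subKr.
Qed.

Lemma frobenius_rcons_lt s g (c : nat) :
  representable_symmetric s g ->
  frobenius (rcons s c) < frobenius s <-> ~ representable s c.
Proof.
move=> sym_s; have frob_g := is_frobenius_symmetric sym_s.
rewrite (frobeniusE frob_g) -(representable_rcons_symmetric c sym_s).
by apply: (frobenius_lt frob_g) => m; exact: representable_rconsW.
Qed.

End Frobenius.

Section BoundedNatPred.

Variables (P : pred nat) (m n : nat).

Lemma card_fset_index_iota :
  #|` [fset i in index_iota m n | P i]%fset|%fset = (\sum_(m <= i < n) P i)%N.
Proof.
rewrite card_imfset //= undup_id ?filter_uniq ?iota_uniq // size_filter.
by rewrite -sum1_count [LHS]big_mkcond.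
Qed.

Lemma set_fset_index_iota : (forall i, P i -> (i < n)%N) ->
  [set i | (m <= i)%N && P i] = [set` [fset i in index_iota m n | P i]%fset].
Proof.
move=> lt_n; apply/seteqP; split=> i /=; rewrite !inE /= mem_index_iota.
  by move=> /andP[-> Pi]; rewrite Pi lt_n.
by move=> /andP[/andP[-> _]].
Qed.

End BoundedNatPred.

Section Gaps.

Implicit Types (s : seq nat) (g : int).

Definition gap s : pred nat := fun n => ~~ `[< representable s n%:Z >].

Lemma gapP s (n : nat) : reflect (~ representable s n) (gap s n).
Proof. exact: asboolPn. Qed.

Lemma gap0 s : gap s 0 = false.
Proof. by apply/gapP => -[]; exact: representable0. Qed.

Lemma gap_le s g (n : nat) : is_frobenius s g -> gap s n -> n%:Z <= g.
Proof. by move=> [_ max_g] /gapP/max_g. Qed.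

Lemma gap_rcons_lt s (c n : nat) : (n < c)%N -> gap (rcons s c) n = gap s n.
Proof.
by move=> lt_nc; congr (~~ _); apply/asbool_equiv_eq/representable_rcons_lt.
Qed.

Lemma gap_rcons s (c : nat) : gap (rcons s c) c = false.
Proof.
apply/gapP => -[]; apply/representable_rcons; exists 1%N.
by rewrite mul1r subrr; exact: representable0.
Qed.

Lemma gap1 (a n : nat) : gap [:: a] n = ~~ (a %| n)%N.
Proof. by congr (~~ _); apply/asboolP/idP => /representable1P. Qed.

Lemma gap_symmetric s g (m n : nat) :
  representable_symmetric s g -> g = m%:Z + n%:Z -> gap s m = ~~ gap s n.
Proof.
move=> sym_s gE; rewrite /gap (asbool_equiv_eq (sym_s m)) asbool_neg.
by rewrite gE addrC addKr.
Qed.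

Lemma double_sum_gap_symmetric s g (n : nat) :
    representable_symmetric s g -> g < n%:Z ->
  (\sum_(0 <= i < n) gap s i)%N%:Z * 2 = g + 1.
Proof.
move=> sym_s lt_gn; have frob_g := is_frobenius_symmetric sym_s.
have [N gE] : exists N : nat, g = N%:Z - 1.
  have : -1 <= g by case: frob_g => _; apply=> /representable_ge0.
  by exists (absz (g + 1)); lia.
rewrite (big_cat_nat (n := N)) //=; last by lia.
rewrite [X in (_ + X)%N]big1_seq ?addn0 => [|i]; last first.
  rewrite mem_index_iota => /and3P[_ le_Ni _]; apply/eqP; rewrite eqb0.
  by apply/negP => /(gap_le frob_g); lia.
have -> : g + 1 = N by lia.
congr Posz; rewrite muln2 big_mkord -addnn.
rewrite {1}(reindex_inj rev_ord_inj) -big_split /=.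
under eq_bigr => i _.
  rewrite (gap_symmetric (n := i) sym_s); last by have := ltn_ord i; lia.
  have -> : (~~ gap s i + gap s i = 1)%N by case: gap.
  over.
by rewrite sum1_card card_ord.
Qed.

End Gaps.

Section CoprimePair.

Variables a b : nat.
Hypotheses (a_gt0 : (0 < a)%N) (co_ab : coprime a b).

Lemma coprime_int_decomposition (m : int) :
  exists x y : int, m = x * a%:Z + y * b%:Z /\ 0 <= y < a%:Z.
Proof.
have /coprimezP[[u v] /= uvE] : coprimez a b by rewrite coprimezE.
exists (m * u + (m * v %/ a)%Z * b), (m * v %% a)%Z; split; last first.
  by rewrite modz_ge0 ?ltz_pmod //; lia.
rewrite -[LHS]mulr1 -uvE mulrDr [m * (v * b)]mulrA {1}(divz_eq (m * v) a).
by ring.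
Qed.

Lemma representable2_ge0 (x y : int) : 0 <= y < a%:Z ->
  representable [:: a; b] (x * a%:Z + y * b%:Z) <-> 0 <= x.
Proof.
move=> /andP[y_ge0 lt_ya]; split=> [/representable2P[x' [y' xyE]]|x_ge0].
  have combE : (y'%:Z - y) * b%:Z = (x - x'%:Z) * a%:Z by lia.
  have /dvdzP[q qE] : (a %| y'%:Z - y)%Z.
    by rewrite -(@Gauss_dvdzl a _ b) ?coprimezE // combE dvdz_mull.
  have q_ge0 : 0 <= q by nia.
  have -> : x = x'%:Z + q * b.
    by apply: (@mulIf _ a%:Z); [lia | move: combE; rewrite qE; lia].
  by lia.
by apply/representable2P; exists `|x|%N, `|y|%N; rewrite !gez0_abs.
Qed.

Lemma representable_symmetric2 :
  representable_symmetric [:: a; b] (a%:Z * b%:Z - a%:Z - b%:Z).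
Proof.
move=> m; have [x [y [-> y_range]]] := coprime_int_decomposition m.
have -> : a%:Z * b%:Z - a%:Z - b%:Z - (x * a%:Z + y * b%:Z)
          = (- x - 1) * a%:Z + (a%:Z - 1 - y) * b%:Z by ring.
rewrite !representable2_ge0 //; last by lia.
by split; lia.
Qed.

End CoprimePair.

Lemma exceptionalE (a b c : nat) : (0 < a)%N -> coprime a b ->
  exceptional a b c <-> (b < c)%N && gap [:: a; b] c.
Proof.
move=> a_gt0 co_ab.
have lt_frobP := frobenius_rcons_lt c (representable_symmetric2 a_gt0 co_ab).
split=> [[-> _ /lt_frobP/gapP //]|/andP[lt_bc /gapP/lt_frobP lt_frob]].
by split=> //; rewrite (eqP co_ab) gcd1n.
Qed.

Lemma sum_gap2_le (a b : nat) : ~~ (a %| b)%N ->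
  (\sum_(0 <= i < b.+1) gap [:: a; b] i + b %/ a + 1 = b)%N.
Proof.
move=> ndvd_ab; have b_gt0 : (0 < b)%N by case: b ndvd_ab; rewrite ?dvdn0.
rewrite divn_count_dvd big_ltn // gap0 add0n -big_split big_nat_recr //=.
rewrite (gap_rcons [:: a] b) (negbTE ndvd_ab) addn0.
rewrite (eq_big_nat _ _ (F2 := fun=> 1%N)) => [|i /andP[_ lt_ib]].
  by rewrite sum_nat_const_nat muln1 subnK.
by rewrite (gap_rcons_lt [:: a] lt_ib) gap1; case: dvdn.
Qed.

Lemma double_sum_gap2_gt (a b : nat) : (1 < a < b)%N -> coprime a b ->
  (\sum_(b.+1 <= i < a * b) gap [:: a; b] i)%N%:Z * 2 =
    (a%:Z - 3) * (b%:Z - 1) + (b %/ a)%N%:Z * 2.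
Proof.
move=> /andP[a_gt1 lt_ab] co_ab.
have ndvd_ab : ~~ (a %| b)%N.
  by apply/negP => /gcdn_idPl; rewrite (eqP co_ab); lia.
have frob_lt : a%:Z * b%:Z - a%:Z - b%:Z < (a * b)%N%:Z by lia.
have sym_ab := representable_symmetric2 (ltnW a_gt1) co_ab.
have := double_sum_gap_symmetric sym_ab frob_lt.
rewrite (big_cat_nat (n := b.+1)) //=; last by nia.
by have := sum_gap2_le ndvd_ab; lia.
Qed.

Theorem theorem4 (a b : nat) (a_ge2 : (2 <= a)%N) (lt_ab : (a < b)%N)
    (co_ab : coprime a b) :
  finite_set [set c : nat | exceptional a b c] /\
  (#|` fset_set [set c : nat | exceptional a b c]|%fset)%:R =
    (a%:R - 3) * (b%:R - 1) / 2 + (b %/ a)%N%:R :> rat.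
Proof.
have a_gt0 : (0 < a)%N := ltnW a_ge2.
have frob_ab := is_frobenius_symmetric (representable_symmetric2 a_gt0 co_ab).
have gap_lt i : gap [:: a; b] i -> (i < a * b)%N.
  by move/(gap_le frob_ab); lia.
have -> : [set c | exceptional a b c] = [set c | (b < c)%N && gap [:: a; b] c].
  by apply/eq_set => c; apply/propext/exceptionalE.
rewrite (set_fset_index_iota b.+1 gap_lt); split; first exact: finite_fset.
rewrite set_fsetK card_fset_index_iota.
have := @double_sum_gap2_gt a b; rewrite a_ge2 lt_ab => /(_ isT co_ab).
move=> /(congr1 (intr : int -> rat)).
by rewrite !(rmorphD, rmorphM, rmorphN) /=; lra.
Qed.
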